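(* There exists a compact set $\mathbb K\subset\mathbb R^2$ which is a non-sticky Kakeya set and has two-dimensional Lebesgue measure zero. Consequently, for every $d>2$ there exists a non-sticky Kakeya set in $\mathbb R^d$ of $d$-dimensional Lebesgue measure zero.
   Context: A Kakeya set in $\mathbb R^d$ is a compact set containing a unit line segment in every direction. For $\mathbf v,\mathbf a\in\mathbb R^{d-1}$ let $L_{\mathbf v,\mathbf a}=\{(\mathbf a,0)+t(\mathbf v,1):t\in\mathbb R\}$; every line not contained in the hyperplane $\{x_d=0\}$ is of this form. The set of such lines is identified with $\mathbb R^{2d-2}$ via $(\mathbf v,\mathbf a)$, with metric $\|\mathbf a-\mathbf b\|+\|\mathbf v-\mathbf w\|$. For a Kakeya set $\mathbb K\subset\mathbb R^d$ let $\mathcal A_{\mathbb K}=\{(\mathbf v,\mathbf a)\in\mathbb R^{2d-2}: L_{\mathbf v,\mathbf a}\cap\mathbb K\text{ contains a unit line segment}\}$. The Kakeya set $\mathbb K$ is called sticky if the packing dimension of $\mathcal A_{\mathbb K}$ equals $d-1$, and non-sticky otherwise (i.e. if the packing dimension of $\mathcal A_{\mathbb K}$ is strictly larger than $d-1$). *)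

(* Defs.v *)
From HB Require Import structures.
From mathcomp Require Import all_boot all_order all_algebra.
From mathcomp Require Import all_classical all_reals all_analysis.

Set Implicit Arguments.
Unset Strict Implicit.
Unset Printing Implicit Defensive.

Import Order.TTheory GRing.Theory Num.Theory.
Import numFieldNormedType.Exports.
Local Open Scope classical_set_scope.
Local Open Scope ring_scope.

Section KakeyaDefs.
Variable R : realType.

Definition enorm (n : nat) (x : 'rV[R]_n) : R :=
  Num.sqrt (\sum_(i < n) (x 0 i) ^+ 2).

Definition cball (T : Type) (dist : T -> T -> R) (x : T) (r : R) : set T :=
  [set y | dist x y <= r].

Definition is_packing (T : Type) (dist : T -> T -> R) (A : set T) (delta : R)
    (N : nat) (x : 'I_N -> T) (r : 'I_N -> R) : Prop :=
  (forall k, A (x k) /\ 0 < r k /\ r k <= delta) /\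
  (forall k l, k != l -> cball dist (x k) (r k) `&` cball dist (x l) (r l) = set0).

(* P^s_delta(A) = sup { sum_k (2 r_k)^s : delta-packings of A }.
   (Sup over finite packings = sup over countable packings, the terms being
   nonnegative.) *)
Definition packing_pre_delta (T : Type) (dist : T -> T -> R) (s : R)
    (A : set T) (delta : R) : \bar R :=
  ereal_sup [set z : \bar R | exists (N : nat) (x : 'I_N -> T) (r : 'I_N -> R),
                is_packing dist A delta x r /\
                z = ((\sum_(k < N) (2 * r k) `^ s)%:E)%E].

(* P^s_0(A) = lim_{delta -> 0} P^s_delta(A) = inf_{delta > 0} P^s_delta(A)
   (P^s_delta(A) is nondecreasing in delta). *)
Definition packing_premeasure (T : Type) (dist : T -> T -> R) (s : R)
    (A : set T) : \bar R :=
  ereal_inf [set packing_pre_delta dist s A delta | delta in [set d : R | 0 < d]].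

Definition packing_measure (T : Type) (dist : T -> T -> R) (s : R)
    (A : set T) : \bar R :=
  ereal_inf [set (\sum_(i <oo) packing_premeasure dist s (F i))%E
            | F in [set F : nat -> set T | A `<=` \bigcup_i F i]].

Definition packing_dim (T : Type) (dist : T -> T -> R) (A : set T) : \bar R :=
  ereal_inf [set s%:E | s in [set s : R | 0 <= s /\ packing_measure dist s A = 0%E]].

Definition segment (d : nat) (p q : 'rV[R]_d) : set 'rV[R]_d :=
  [set (1 - l) *: p + l *: q | l in [set l : R | 0 <= l <= 1]].

Definition Kakeya (d : nat) (K : set 'rV[R]_d) : Prop :=
  compact K /\
  forall e : 'rV[R]_d, enorm e = 1 ->
    exists x : 'rV[R]_d, segment x (x + e) `<=` K.

(* The line L_{v,a} = {(a,0) + t (v,1) : t in R} in R^(n+1), parametrised by t;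
   the last coordinate (index ord_max) is the x_d coordinate. *)
Definition line_pt (n : nat) (v a : 'rV[R]_n) (t : R) : 'rV[R]_n.+1 :=
  \row_(i < n.+1) match unlift ord_max i with
                  | Some j => a 0 j + t * v 0 j
                  | None => t
                  end.

Definition line_has_unit_segment (n : nat) (K : set 'rV[R]_n.+1)
    (v a : 'rV[R]_n) : Prop :=
  exists t0 t1 : R,
    enorm (line_pt v a t1 - line_pt v a t0) = 1 /\
    segment (line_pt v a t0) (line_pt v a t1) `<=` K.

Definition lineset (n : nat) (K : set 'rV[R]_n.+1) : set ('rV[R]_n * 'rV[R]_n) :=
  [set va | line_has_unit_segment K va.1 va.2].

Definition line_dist (n : nat) (p q : 'rV[R]_n * 'rV[R]_n) : R :=
  enorm (p.2 - q.2) + enorm (p.1 - q.1).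

Definition non_sticky (n : nat) (K : set 'rV[R]_n.+1) : Prop :=
  ((n%:R : R)%:E < packing_dim (@line_dist n) (lineset K))%E.

Definition box (d : nat) (lo hi : 'rV[R]_d) : set 'rV[R]_d :=
  [set x | forall i, lo 0 i <= x 0 i <= hi 0 i].

Definition box_vol (d : nat) (lo hi : 'rV[R]_d) : R :=
  \prod_(i < d) (hi 0 i - lo 0 i).

Definition lebesgue_null (d : nat) (A : set 'rV[R]_d) : Prop :=
  forall eps : R, 0 < eps ->
    exists lo hi : nat -> 'rV[R]_d,
      (forall k i, lo k 0 i <= hi k 0 i) /\
      A `<=` \bigcup_k box (lo k) (hi k) /\
      (forall N, \sum_(k < N) box_vol (lo k) (hi k) < eps).

End KakeyaDefs.

(* Main.v *)
(* The Kakeya set is K = closure {x | (x_0, x_n) in P, |x_i| <= 3}, where P is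
   the union of two null planar sets.

   The first is a Besicovitch set: the segments x = t s - f(s), 0 <= t <= 1,
   for 0 <= s <= 1, and their images under reflection and exchange of the axes,
   with f(s) = sum_m a_m (p_{m+1}(s) - p_m(s)), where p_m(s)
   rounds s down to a multiple of 1/N_m and (a_m) runs over all fractions
   j/(n+1) with 0 <= j <= n.  For t near a_m the terms t (s - p_m(s)) and
   a_m (s - p_m(s)) almost cancel, so that the horizontal slice at height t is
   covered by N_m + 1 intervals of length O(1/(n N_m)).

   The second consists of the lines x = a + t v with a, v in a Cantor set C whose
   covering numbers are tiny at some scales, which makes the union of these
   lines null, and whose packing numbers are huge at other scales, which gives
   C^(2n) packing dimension at least 3n/2 > n. *)
Require Import Defs.
From HB Require Import structures.
From mathcomp Require Import all_boot all_order all_algebra.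
From mathcomp Require Import all_classical all_reals all_analysis.
From mathcomp Require Import ring lra zify.

Set Implicit Arguments.
Unset Strict Implicit.
Unset Printing Implicit Defensive.

Import Order.TTheory GRing.Theory Num.Theory.
Import numFieldNormedType.Exports.
Local Open Scope classical_set_scope.
Local Open Scope ring_scope.

(** * Finite covers of planar sets by rectangles of small total area *)

Section PlaneCovers.
Variable R : realType.
Implicit Types (P Q : R -> R -> Prop) (A B : R).

(* A rectangle is encoded as (lower-left corner, (width, height)). *)
Definition rect (b : (R * R) * (R * R)) (x y : R) : Prop :=
  b.1.1 <= x <= b.1.1 + b.2.1 /\ b.1.2 <= y <= b.1.2 + b.2.2.

(** The cover is finite rather than countable, so that its union is closed and still covers the
    closure of the set. *)
Definition covered P A : Prop := exists bs : seq ((R * R) * (R * R)),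
  [/\ forall b, b \in bs -> 0 <= b.2.1 /\ 0 <= b.2.2,
      forall x y, P x y -> exists2 b, b \in bs & rect b x y &
      \sum_(b <- bs) b.2.1 * b.2.2 <= A].

Lemma covered_sub P Q A B : (forall x y, P x y -> Q x y) -> A <= B ->
  covered Q A -> covered P B.
Proof.
move=> PQ AB [bs [bs0 bsQ bsA]]; exists bs; split => //.
  by move=> x y /PQ /bsQ.
exact: le_trans AB.
Qed.

Lemma coveredU P Q A B : covered P A -> covered Q B ->
  covered (fun x y => P x y \/ Q x y) (A + B).
Proof.
move=> [bs [bs0 bsP bsA]] [cs [cs0 csQ csB]]; exists (bs ++ cs); split.
- by move=> b; rewrite mem_cat => /orP[/bs0|/cs0].
- move=> x y [/bsP|/csQ] [b bin ?]; exists b => //; rewrite mem_cat bin //.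
  by rewrite orbT.
- by rewrite big_cat lerD.
Qed.

Lemma covered_seq (I : eqType) (s : seq I) (P : I -> R -> R -> Prop) A :
  (forall i, i \in s -> covered (P i) A) ->
  covered (fun x y => exists2 i, i \in s & P i x y) (A *+ size s).
Proof.
elim: s => [_|i s IH cov_s].
  by exists [::]; split => // [x y [i //]|]; rewrite big_nil.
have cov_tl : covered (fun x y => exists2 j, j \in s & P j x y) (A *+ size s).
  by apply: IH => j js; apply: cov_s; rewrite in_cons js orbT.
have cov_hd := cov_s i (mem_head _ _).
apply: (covered_sub _ _ (coveredU cov_hd cov_tl)); last by rewrite mulrS.
move=> x y [j]; rewrite in_cons => /orP[/eqP->|]; first by left.
by move=> js Pj; right; exists j.
Qed.

Lemma covered_rect (b : (R * R) * (R * R)) : 0 <= b.2.1 -> 0 <= b.2.2 ->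
  covered (rect b) (b.2.1 * b.2.2).
Proof.
move=> w0 h0; exists [:: b]; split.
- by move=> c; rewrite inE => /eqP ->.
- by move=> x y ?; exists b => //; rewrite inE.
- by rewrite big_seq1.
Qed.

Lemma covered_flip P A : covered P A -> covered (fun x y => P (- x) y) A.
Proof.
move=> [bs [bs0 bsP bsA]].
exists [seq ((- b.1.1 - b.2.1, b.1.2), b.2) | b <- bs]; split.
- by move=> _ /mapP[b /bs0 ? ->].
- move=> x y /bsP[b bin [/= xb yb]].
  exists ((- b.1.1 - b.2.1, b.1.2), b.2).
    by apply/mapP; exists b.
  by split => //=; lra.
- by rewrite big_map.
Qed.

Lemma covered_swap P A : covered P A -> covered (fun x y => P y x) A.
Proof.
move=> [bs [bs0 bsP bsA]].
exists [seq ((b.1.2, b.1.1), (b.2.2, b.2.1)) | b <- bs]; split.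
- by move=> _ /mapP[b /bs0[? ?] ->].
- move=> x y /bsP[b bin [/= xb yb]].
  exists ((b.1.2, b.1.1), (b.2.2, b.2.1)); last by [].
  by apply/mapP; exists b.
- rewrite big_map; apply: le_trans bsA.
  by under eq_bigr => b _ do rewrite /= mulrC.
Qed.

Lemma subdivide (h t0 t : R) (M : nat) : (0 < M)%N ->
  t0 <= t <= t0 + M%:R * h ->
  exists2 j, (j < M)%N & t0 + j%:R * h <= t <= t0 + j.+1%:R * h.
Proof.
elim: M => // -[|M] IH _ tM; first by exists 0%N => //; rewrite mul0r; lra.
have [tl|tl] := lerP t (t0 + M.+1%:R * h).
  by have [|j jM ?] := IH isT; [lra|exists j => //; lia].
by exists M.+1 => //; rewrite (ltW tl); lra.
Qed.

(** In each of M slices of height h = w/M the axis, of slope at most 1, drifts by at most h. With a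
    margin of 2h on both sides a rectangle of width 5h suffices. *)
Lemma covered_tube (t0 w c p : R) (M : nat) : (0 < M)%N -> 0 < w ->
  0 <= p <= 1 ->
  covered (fun x t => t0 <= t <= t0 + w /\
                      `|x - (c + p * t)| <= 2 * w / M%:R) (5 * w ^+ 2 / M%:R).
Proof.
move=> M0 w0 p01; set h := w / M%:R.
have M0R : 0 < M%:R :> R by rewrite ltr0n.
have h0 : 0 < h by rewrite divr_gt0.
have wE : w = M%:R * h by rewrite /h mulrC divfK // gt_eqF.
pose b j : (R * R) * (R * R) :=
  ((c + p * (t0 + j%:R * h) - 2 * h, t0 + j%:R * h), (5 * h, h)).
have bc j : j \in iota 0 M -> covered (rect (b j)) (5 * h * h).
  by move=> _; apply: covered_rect => /=; lra.
apply: (covered_sub _ _ (covered_seq bc)).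
  move=> x t [tw xt].
  have [|j jM tj] := @subdivide h t0 t M M0; first by rewrite -wE.
  exists j; rewrite ?mem_iota //; split => /=.
    have : `|x - (c + p * t)| <= 2 * h by rewrite /h mulrA.
    rewrite ler_norml => xh.
    move: tj; rewrite -natr1 => tj.
    have : 0 <= p * (t - (t0 + j%:R * h)) <= h.
      by apply/andP; split; nra.
    lra.
  by move: tj; rewrite -natr1; lra.
rewrite size_iota -[X in X <= _]mulr_natl.
suff -> : M%:R * (5 * h * h) = 5 * w ^+ 2 / M%:R by [].
by rewrite /h; field; rewrite gt_eqF.
Qed.

End PlaneCovers.
Arguments covered {R}.

(** * A null planar set with a unit segment in every direction *)

Section Besicovitch.
Variable R : realType.

(* Step [m] uses the slope [j / n.+1] and the base [n.+1] whenever [m] codes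
   the pair [(j, n)] with [j <= n], so that every such pair occurs. *)
Definition step_code (m : nat) : nat * nat := odflt (0%N, 0%N) (unpickle m).
Definition base (m : nat) : nat := (step_code m).2.+1.
Definition slope (m : nat) : R :=
  ((step_code m).1 %% (step_code m).2.+1)%:R / (step_code m).2.+1%:R.

(** These are the N_m; each divides the next, so the grids of multiples of 1/N_m are nested. *)
Fixpoint scale (m : nat) : nat :=
  if m is m'.+1 then (scale m' * base m')%N else 1%N.

Definition round (m : nat) (s : R) : R :=
  (Num.truncn (s * (scale m)%:R))%:R / (scale m)%:R.

Definition partial_shift (m : nat) (s : R) : R :=
  \sum_(l < m) slope l * (round l.+1 s - round l s).

(** For s >= 0 the partial sums are nondecreasing and bounded, so this supremum is the sum of the
    series f(s). *)
Definition shift (s : R) : R := sup (range (partial_shift ^~ s)).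

Lemma slope01 m : 0 <= slope m <= 1.
Proof.
rewrite /slope divr_ge0 ?ler0n //= ler_pdivrMr ?ltr0n // mul1r ler_nat.
by rewrite ltnW // ltn_mod.
Qed.

Lemma slope_pickle n j : (j <= n)%N ->
  slope (pickle (j, n)) = j%:R / n.+1%:R /\ base (pickle (j, n)) = n.+1.
Proof.
by move=> jn; rewrite /slope /base /step_code pickleK /= modn_small.
Qed.

Lemma scale_gt0 m : (0 < scale m)%N.
Proof. by elim: m => //= m IH; rewrite muln_gt0 IH. Qed.

Let scaleR_gt0 m : 0 < (scale m)%:R :> R.
Proof. by rewrite ltr0n scale_gt0. Qed.

Lemma scale_dvd l m : (l <= m)%N -> (scale l %| scale m)%N.
Proof.
move=> /subnK <-; elim: (m - l)%N => //= k /dvdn_trans; apply.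
exact: dvdn_mulr.
Qed.

Lemma round_le m s : 0 <= s -> round m s <= s.
Proof.
move=> s0; rewrite /round ler_pdivrMr //.
by rewrite truncn_le mulr_ge0 // ler0n.
Qed.

Lemma round_ge0 m s : 0 <= round m s.
Proof. by rewrite divr_ge0 // ler0n. Qed.

Lemma round_gt m s : s - (scale m)%:R^-1 < round m s.
Proof.
rewrite /round ltr_pdivlMr // mulrBl mulVf ?gt_eqF //.
by rewrite ltrBlDr natr1 truncnS_gt.
Qed.

Lemma round_mono m s t : s <= t -> round m s <= round m t.
Proof.
move=> st; rewrite /round ler_pM2r ?invr_gt0 // ler_nat le_truncn //.
by rewrite ler_pM2r.
Qed.

(** Since N_l divides N_m, the coarse grid is part of the fine one, and rounding down to the fine
    grid never passes below a coarse grid point. *)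
Lemma round_max l m s : 0 <= s -> (l <= m)%N -> round l (round m s) = round l s.
Proof.
move=> s0 lm; apply/eqP; rewrite eq_le round_mono ?round_le //=.
rewrite /round ler_pM2r ?invr_gt0 // ler_nat.
rewrite truncn_ge_nat; last by rewrite mulr_ge0 // ?round_ge0.
have /dvdnP[q mq] := scale_dvd lm.
set x := Num.truncn (s * (scale l)%:R).
have q0 : 0 < q%:R :> R.
  by rewrite ltr0n; have := scale_gt0 m; rewrite mq; case: q {mq}.
have xs : x%:R <= s * (scale l)%:R by rewrite truncn_le mulr_ge0.
have : (x * q <= Num.truncn (s * (scale m)%:R))%N.
  rewrite truncn_ge_nat ?mulr_ge0 // mq !natrM mulrCA mulrC.
  by rewrite ler_pM2l.
rewrite -(ler_nat R) natrM => xq.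
rewrite -(ler_pM2r q0) (le_trans xq) //.
by rewrite -mulrA -natrM [(scale l * q)%N]mulnC -mq divfK // gt_eqF.
Qed.

Lemma round_nondec l m s : 0 <= s -> (l <= m)%N -> round l s <= round m s.
Proof.
by move=> s0 lm; rewrite -(round_max s0 lm) round_le // round_ge0.
Qed.

(** Only roundings of level at most m enter, so the partial sum depends on the grid point alone;
    finitely many lines then serve all s in [0,1]. *)
Lemma partial_shift_round m s : 0 <= s ->
  partial_shift m (round m s) = partial_shift m s.
Proof.
move=> s0; apply: eq_bigr => l _.
by rewrite !round_max // ltnW.
Qed.

(** Each new term is a slope in [0,1] times a nonnegative increment of the rounding, and these
    increments telescope. *)
Lemma partial_shift_diff l m s : 0 <= s -> (l <= m)%N ->
  0 <= partial_shift m s - partial_shift l s <= round m s - round l s.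
Proof.
move=> s0 /subnK <-; elim: (m - l)%N => [|k IH]; first by rewrite add0n; lra.
rewrite addSn /partial_shift big_ord_recr /= -/(partial_shift _ _).
rewrite -/(partial_shift l s).
have a01 := slope01 (k + l).
have dr := round_nondec s0 (leqnSn (k + l)).
set x := slope _ in a01 *; set d := round _.+1 s - _.
have d0 : 0 <= d by rewrite /d; lra.
have xd : 0 <= x * d <= d by apply/andP; split; nra.
by rewrite /d in xd *; lra.
Qed.

Lemma shift_bounds m s : 0 <= s ->
  partial_shift m s <= shift s <= partial_shift m s + (s - round m s).
Proof.
move=> s0.
have ub k : partial_shift k s <= partial_shift m s + (s - round m s).
  have [km|/ltnW mk] := leqP k m.
    have := partial_shift_diff s0 km; have := round_le m s0; lra.
  have := partial_shift_diff s0 mk; have := round_le k s0; lra.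
apply/andP; split.
  by apply: ub_le_sup; [exists (partial_shift m s + (s - round m s))
    => _ [k _ <-]; exact: ub|exists m].
by apply: ge_sup; [exists (partial_shift m s); exists m|move=> _ [k _ <-]; exact: ub].
Qed.

Lemma shift01 s : 0 <= s <= 1 -> 0 <= shift s <= 1.
Proof.
move=> /andP[s0 s1]; have := shift_bounds 0 s0.
by rewrite /partial_shift big_ord0; have := round_ge0 0 s; lra.
Qed.

(* On [a_m <= t <= a_m + 1/(n+1)] the line of slope [s] stays close to the line
   of slope [round m s], because the slope [a_m] of the shift cancels [t]. *)
Lemma shift_approx n j s t : (j <= n)%N -> 0 <= s ->
  j%:R / n.+1%:R <= t <= j%:R / n.+1%:R + n.+1%:R^-1 ->
  let m := pickle (j, n) in
  `|t * s - shift s - (t * round m s - partial_shift m s)|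
     <= 2 * n.+1%:R^-1 / (scale m)%:R.
Proof.
move=> jn s0; move: (slope_pickle jn) => [].
set m := pickle (j, n) => <- bE tj /=.
have /andP[lo hi] := shift_bounds m.+1 s0.
have FS : partial_shift m.+1 s =
    partial_shift m s + slope m * (round m.+1 s - round m s).
  by rewrite /partial_shift big_ord_recr.
have r1 := round_gt m s; have r1' := round_le m s0.
have r2 := round_gt m.+1 s; have r2' := round_le m.+1 s0.
have a01 := slope01 m.
move: r2; rewrite /= bE natrM invfM mulrC.
set e := n.+1%:R^-1 in tj *; set q := (scale m)%:R^-1 in r1 * => r2.
have q0 : 0 < q by rewrite invr_gt0.
have e0 : 0 < e by rewrite invr_gt0.
rewrite FS in lo hi.
(* The error is the quantity in [u0] plus the one in [v0] minus a tail in [0, s - p_{m+1}(s)]; each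
   of the three lies in [0, e q]. *)
have u0 : 0 <= (t - slope m) * (s - round m s) <= e * q.
  by apply/andP; split; [nra|apply: ler_pM; lra].
have v0 : 0 <= slope m * (s - round m.+1 s) <= e * q.
  by apply/andP; split; [nra|apply: le_trans (_ : s - round m.+1 s <= _); nra].
by rewrite ler_norml -mulrA; apply/andP; split; nra.
Qed.

Definition besicovitch (x t : R) : Prop :=
  0 <= t <= 1 /\ exists2 s, 0 <= s <= 1 & x = t * s - shift s.

Lemma besicovitch_bounded x t : besicovitch x t -> `|x| <= 3 /\ `|t| <= 3.
Proof.
move=> [t01 [s s01 ->]]; have := shift01 s01; rewrite !ler_norml => F01.
have : 0 <= t * s <= 1 by apply/andP; split; nra.
by split; lra.
Qed.

(** Each of the n+1 strips of height e = 1/(n+1) uses its own m. There N_m + 1 tubes of area 5 e^2 /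
    N_m suffice, at most 10 e^2 per strip and 10 e in all. *)
Lemma besicovitch_covered_strip n : covered besicovitch (10 / n.+1%:R).
Proof.
set e : R := n.+1%:R^-1.
have e0 : 0 < e by rewrite invr_gt0.
pose tube j i x t := let m := pickle (j, n) in let r := i%:R / (scale m)%:R in
  j%:R * e <= t <= j%:R * e + e /\
  `|x - (- partial_shift m r + r * t)| <= 2 * e / (scale m)%:R.
have cov_strip j : j \in iota 0 n.+1 ->
    covered (fun x t => exists2 i, i \in iota 0 (scale (pickle (j, n))).+1 &
      tube j i x t) (10 * e ^+ 2).
  rewrite mem_iota /= => jn; set N := scale (pickle (j, n)).
  have N0 : 0 < N%:R :> R := scaleR_gt0 _.
  have N1 : 1 <= N%:R :> R by rewrite ler1n scale_gt0.
  have cov_tube i : i \in iota 0 N.+1 -> covered (tube j i) (5 * e ^+ 2 / N%:R).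
    rewrite mem_iota add0n ltnS => /andP[_ iN].
    apply: covered_tube (scale_gt0 _) e0 _.
    by rewrite divr_ge0 // ler_pdivrMr // mul1r ler_nat.
  apply: (covered_sub _ _ (covered_seq cov_tube)) => //.
  rewrite size_iota -[X in X <= _]mulr_natl -natr1.
  have -> : (N%:R + 1) * (5 * e ^+ 2 / N%:R) = 5 * e ^+ 2 * (1 + N%:R^-1).
    by field; rewrite gt_eqF.
  have : N%:R^-1 <= 1 :> R by rewrite invf_le1.
  have : 0 <= e ^+ 2 := sqr_ge0 _; nra.
apply: (covered_sub _ _ (covered_seq cov_strip)).
  move=> x t [t01 [s /andP[s0 s1] ->]].
  have [|j jn tj] := @subdivide R e 0 t n.+1 isT.
    by rewrite add0r mulfV.
  exists j; rewrite ?mem_iota //.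
  have tj' : j%:R * e <= t <= j%:R * e + e by move: tj; rewrite -natr1; lra.
  have ap := shift_approx (jn : (j <= n)%N) s0 tj'; simpl in ap.
  set m := pickle (j, n) in ap *.
  have N0 := scaleR_gt0 m.
  (* The index of the grid point below s; s = 1 yields the index N_m, hence N_m + 1 tubes. *)
  exists (Num.truncn (s * (scale m)%:R)).
    rewrite mem_iota add0n ltnS /= -(ler_nat R).
    rewrite (le_trans (_ : _ <= s * (scale m)%:R)) //.
      by rewrite truncn_le mulr_ge0.
    by rewrite ler_piMl.
  split => //=; rewrite -/(round m s) partial_shift_round //.
  by rewrite (addrC (- _)) [round m s * t]mulrC.
rewrite size_iota -[X in X <= _]mulr_natl.
suff -> : n.+1%:R * (10 * e ^+ 2) = 10 * e by [].
by rewrite expr2 mulrCA (mulrA n.+1%:R) mulfV // mul1r.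
Qed.

Lemma archimedean_inv (c eta : R) : 0 < eta -> exists n, c / n.+1%:R <= eta.
Proof.
move=> eta0; exists (Num.truncn (c / eta)).
rewrite ler_pdivrMr ?ltr0n // mulrC -ler_pdivrMr //.
exact: ltW (truncnS_gt _).
Qed.

Lemma besicovitch_null eta : 0 < eta -> covered besicovitch eta.
Proof.
move=> /(archimedean_inv 10)[n ne].
exact: covered_sub ne (besicovitch_covered_strip n).
Qed.

Definition kakeya_plane (x y : R) : Prop :=
  (besicovitch x y \/ besicovitch (- x) y) \/
  (besicovitch y x \/ besicovitch (- y) x).

Lemma kakeya_plane_bounded x y : kakeya_plane x y -> `|x| <= 3 /\ `|y| <= 3.
Proof.
by move=> [[]|[]] /besicovitch_bounded; rewrite ?normrN // => -[].
Qed.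

Lemma kakeya_plane_null eta : 0 < eta -> covered kakeya_plane eta.
Proof.
move=> eta0; have /besicovitch_null c1 : 0 < eta / 4 by lra.
have c2 := covered_flip c1.
have c3 := coveredU c1 c2.
apply: (covered_sub _ _ (coveredU c3 (covered_swap c3))) => //; lra.
Qed.

(** Up to reflection, (p, q) is q times (s, 1) with s = |p|/|q| in [0,1], and the set contains a
    segment of slope s over all heights in [0,1]. *)
Lemma besicovitch_segment p q : `|p| <= `|q| -> `|q| <= 1 ->
  exists x y, (forall l, 0 <= l <= 1 -> besicovitch (x + l * p) (y + l * q)) \/
    (forall l, 0 <= l <= 1 -> besicovitch (- (x + l * p)) (y + l * q)).
Proof.
have [->|q0] := eqVneq q 0.
  rewrite normr0 normr_le0 => /eqP -> _; exists (- shift 0), 0; left => l _.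
  by rewrite !mulr0 !addr0; split; [lra|exists 0; [lra|rewrite mul0r sub0r]].
move=> pq q1.
set s := `|p| / `|q|.
have s01 : 0 <= s <= 1.
  by rewrite divr_ge0 //= ler_pdivrMr ?normr_gt0 // mul1r.
(* A descending segment starts at the top, so that its heights stay in [0,1]. *)
pose y : R := if q < 0 then 1 else 0.
have yl l : 0 <= l <= 1 -> 0 <= y + l * q <= 1.
  rewrite /y; case: ifP => [qn|/negbT]; rewrite -?leNgt => l01.
    by move: q1; rewrite ltr0_norm // => q1; apply/andP; split; nra.
  by move=> qp; rewrite ger0_norm // in q1; apply/andP; split; nra.
have pE : p = s * q \/ p = - (s * q).
  have := divfK (_ : `|q| != 0) `|p|; rewrite normr_eq0 -/s => /(_ q0).
  by case: (ger0P p) => _; case: (ger0P q) => _ ?; [left|right|right|left]; lra.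
case: pE => pE.
  exists (y * s - shift s), y; left => l l01; split; first exact: yl.
  by exists s => //; rewrite pE; ring.
exists (- (y * s - shift s)), y; right => l l01; split; first exact: yl.
by exists s => //; rewrite pE; ring.
Qed.

Lemma kakeya_plane_segment p q : `|p| <= 1 -> `|q| <= 1 ->
  exists x y, forall l, 0 <= l <= 1 -> kakeya_plane (x + l * p) (y + l * q).
Proof.
move=> p1 q1; have [pq|/ltW qp] := lerP `|p| `|q|.
  have [x [y [] H]] := besicovitch_segment pq q1; exists x, y => l /H.
    by left; left.
  by left; right.
have [x [y [] H]] := besicovitch_segment qp p1; exists y, x => l /H.
  by right; left.
by right; right.
Qed.

End Besicovitch.

(** * A Cantor set of parameters whose lines have null union *)

Section CantorSet.
Variable R : realType.

(* A level-k interval of length [1 / res k] carries [branch k] equally spaced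
   level-(k+1) intervals.  The branching is large enough for full packing
   dimension, while the next length is small enough for null projections. *)
Definition branching (r : nat) : nat := ((4 * r) ^ 3)%N.
Fixpoint res (k : nat) : nat :=
  if k is k'.+1 then ((branching (res k') * res k') ^ 3)%N else 1%N.
Definition branch (k : nat) : nat := branching (res k).

Definition width (k : nat) : R := (res k)%:R^-1.
Definition spacing (k : nat) : R := ((branch k)%:R * (res k)%:R)^-1.

Fixpoint corners (k : nat) : seq R :=
  if k is k'.+1 then
    [seq x + j%:R * spacing k' | x <- corners k', j <- iota 0 (branch k')]
  else [:: 0].

Definition cantor (c : R) : Prop :=
  forall k, exists2 x, x \in corners k & x <= c <= x + width k.

Lemma resS k : res k.+1 = ((branch k * res k) ^ 3)%N.
Proof. by []. Qed.

Lemma res_gt0 k : (0 < res k)%N.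
Proof.
elim: k => // k IH; rewrite resS expn_gt0 muln_gt0 IH andbT.
by rewrite /branch /branching expn_gt0 muln_gt0 IH.
Qed.

Lemma branch_gt1 k : (1 < branch k)%N.
Proof.
have r0 := res_gt0 k; rewrite /branch /branching.
apply: (@leq_trans (2 ^ 3)%N) => //.
by rewrite leq_exp2r //; lia.
Qed.

Lemma branch_gt0 k : (0 < branch k)%N.
Proof. exact: ltnW (branch_gt1 k). Qed.

Lemma width_gt0 k : 0 < width k.
Proof. by rewrite invr_gt0 ltr0n res_gt0. Qed.

Lemma spacing_gt0 k : 0 < spacing k.
Proof. by rewrite invr_gt0 mulr_gt0 // ltr0n ?branch_gt0 ?res_gt0. Qed.

Lemma branch_spacing k : (branch k)%:R * spacing k = width k.
Proof.
rewrite /spacing /width invfM mulrA mulfV ?mul1r //.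
by rewrite pnatr_eq0 -lt0n branch_gt0.
Qed.

(** Sibling intervals are thus separated by gaps of at least half a spacing, which keeps the packing
    balls disjoint. *)
Lemma width_succ k : width k.+1 <= spacing k / 2.
Proof.
rewrite /width /spacing resS -invfM -natrM.
have pos : (0 < branch k * res k)%N by rewrite muln_gt0 branch_gt0 res_gt0.
have big : (1 < branch k * res k)%N.
  by apply: leq_trans (branch_gt1 k) _; rewrite leq_pmulr // res_gt0.
rewrite lef_pV2 ?posrE ?mulr_gt0 ?ltr0n ?expn_gt0 ?pos //.
rewrite -natrM ler_nat expnS leq_mul2l; apply/orP; right.
by apply: (leq_trans big); rewrite expnS leq_pmulr // expn_gt0 pos.
Qed.

Lemma corners_succ k x j : x \in corners k -> (j < branch k)%N ->
  x + j%:R * spacing k \in corners k.+1.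
Proof. by move=> xk jM; apply: allpairs_f; rewrite // mem_iota. Qed.

Lemma nested_interval k j : (j < branch k)%N ->
  j%:R * spacing k + width k.+1 <= width k.
Proof.
move=> jM; rewrite -(branch_spacing k).
have ws := width_succ k; have s0 := spacing_gt0 k.
apply: (@le_trans _ _ ((j%:R + 1) * spacing k)); first by lra.
by rewrite ler_pM2r // natr1 ler_nat.
Qed.

Lemma corners_bounds k x : x \in corners k -> 0 <= x <= 1 - width k.
Proof.
elim: k x => [x|k IH _ /allpairsP[[x j] /= [/IH x01 jM ->]]].
  by rewrite inE => /eqP ->; rewrite /width /= invr1; lra.
rewrite mem_iota in jM; have := nested_interval jM.
have : 0 <= j%:R * spacing k by rewrite mulr_ge0 // ltW // spacing_gt0.
lra.
Qed.

Lemma cantor01 c : cantor c -> 0 <= c <= 1.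
Proof. by move=> /(_ 0%N)[x /corners_bounds]; lra. Qed.

(** The cube in [res] makes the bound inductive. It gives (k+1) size^2 <= size^3 <= [res k], so that
    size^2 tubes of area of order 1 / [res k] have small total area. *)
Lemma size_corners k : (k < size (corners k))%N /\ (size (corners k) ^ 3 <= res k)%N.
Proof.
elim: k => // k [IH1 IH2].
rewrite resS /= size_allpairs size_iota mulnC; split.
  apply: leq_trans (leq_mul (branch_gt1 k) IH1); lia.
rewrite leq_exp2r // leq_mul2l; apply/orP; right.
have s0 := leq_ltn_trans (leq0n _) IH1.
by apply: leq_trans IH2; rewrite expnS leq_pmulr // expn_gt0 s0.
Qed.

Lemma width_small k : width k <= k.+1%:R^-1.
Proof.
have [k1 k2] := size_corners k.
rewrite /width lef_pV2 ?posrE ?ltr0n ?res_gt0 // ler_nat.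
have s0 := leq_ltn_trans (leq0n _) k1.
by apply: leq_trans k1 (leq_trans _ k2); rewrite expnS leq_pmulr // expn_gt0 s0.
Qed.

Definition cantor_lines (x t : R) : Prop :=
  0 <= t <= 1 /\ exists a v, [/\ cantor a, cantor v & x = a + t * v].

(** Replacing a and v by corners of their level-k intervals moves the line by at most twice the
    width, so one tube per pair of corners suffices. *)
Lemma cantor_lines_covered k : covered cantor_lines (5 / k.+1%:R).
Proof.
have [k1 k2] := size_corners k.
have r0 : 0 < (res k)%:R :> R by rewrite ltr0n res_gt0.
pose tube (ij : R * R) (x t : R) :=
  0 <= t <= 0 + 1 /\ `|x - (ij.1 + ij.2 * t)| <= 2 * 1 / (res k)%:R.
pose ps := [seq (x, y) | x <- corners k, y <- corners k].
have cov_tube ij : ij \in ps -> covered (tube ij) (5 * 1 ^+ 2 / (res k)%:R).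
  move=> /allpairsP[[x y] /= [_ yk ->]] /=.
  apply: covered_tube; rewrite ?res_gt0 //.
  by have := corners_bounds yk; have := width_gt0 k; rewrite /=; lra.
apply: (covered_sub _ _ (covered_seq cov_tube)).
  move=> x t [t01 [a [v [/(_ k)[y yk ya] /(_ k)[z zk zv] ->]]]].
  exists (y, z); first by rewrite /ps allpairs_f.
  rewrite /tube add0r /=; split=> //; rewrite mulr1 -/(width k) ler_norml.
  have : 0 <= t * (v - z) <= width k.
    apply/andP; split; first by rewrite mulr_ge0 //; lra.
    by apply: (@le_trans _ _ (v - z)); rewrite ?ler_piMl //; lra.
  by rewrite mulrBr; lra.
rewrite size_allpairs -[X in X <= _]mulr_natl expr1n mulr1.
rewrite mulrA ler_pdivrMr // mulrAC ler_pdivlMr ?ltr0n //.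
rewrite [_ * 5]mulrC -mulrA ler_pM2l // -natrM ler_nat.
by apply: leq_trans k2; rewrite !expnS expn0 muln1 mulnA leq_mul2l k1 orbT.
Qed.

Lemma cantor_lines_null eta : 0 < eta -> covered cantor_lines eta.
Proof.
move=> /(archimedean_inv 5)[n ne].
exact: covered_sub ne (cantor_lines_covered n).
Qed.

End CantorSet.

(** * Lower bound for the packing dimension *)

Section PackingDimension.
Variables (R : realType) (n : nat).

Local Notation line := ('rV[R]_n * 'rV[R]_n)%type.
Local Notation index := ('I_n + 'I_n)%type.

Definition line_coord (p : line) (i : index) : R :=
  match i with inl j => p.2 0 j | inr j => p.1 0 j end.

Definition cell (k : nat) (X : index -> R) : set line :=
  [set p | forall i, X i <= line_coord p i <= X i + width R k].

Definition subcorner (k : nat) (X : index -> R)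
    (d : {ffun index -> 'I_(branch k)}) (i : index) : R :=
  X i + (d i)%:R * spacing R k.

(** The spacing equals 4 (4 [res k])^(-4), so this is an eighth of it, in the power form that the
    mass computation needs. *)
Definition radius (k : nat) : R := (4 * (res k)%:R) `^ (- 4) / 2.

Lemma coord_le_enorm m (x : 'rV[R]_m) i : `|x 0 i| <= enorm x.
Proof.
rewrite -sqrtr_sqr ler_wsqrtr // (bigD1 i) //= lerDl.
by apply: sumr_ge0 => j _; exact: sqr_ge0.
Qed.

Lemma coord_le_line_dist (p q : line) i :
  `|line_coord p i - line_coord q i| <= line_dist p q.
Proof.
have e0 m (x : 'rV[R]_m) : 0 <= enorm x by exact: sqrtr_ge0.
case: i => j; rewrite /line_dist /=.
  have := coord_le_enorm (p.2 - q.2) j; rewrite !mxE => le_j.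
  by apply: (le_trans le_j); rewrite lerDl.
have := coord_le_enorm (p.1 - q.1) j; rewrite !mxE => le_j.
by apply: (le_trans le_j); rewrite lerDr.
Qed.

Lemma radius_gt0 k : 0 < radius k.
Proof.
by rewrite divr_gt0 // powR_gt0 // mulr_gt0 // ltr0n res_gt0.
Qed.

Lemma radius_spacing k : 4 * radius k = spacing R k / 2.
Proof.
have r0 : 0 < (res k)%:R :> R by rewrite ltr0n res_gt0.
have -> : radius k = ((4 * (res k)%:R) ^+ 4)^-1 / 2.
  by rewrite /radius powRN powR_mulrn // mulr_ge0 // ltW.
rewrite /spacing /branch /branching natrX natrM.
by field; rewrite gt_eqF.
Qed.

Lemma radius_small k : radius k <= k.+1%:R^-1.
Proof.
have := radius_spacing k; have := width_succ R k.
have := branch_spacing R k; have := width_small R k.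
have s0 := spacing_gt0 R k; have r0 := radius_gt0 k.
have : 1 <= (branch k)%:R :> R by rewrite ler1n branch_gt0.
move=> b1 wk bs ws rs.
have : spacing R k <= (branch k)%:R * spacing R k by rewrite ler_peMl // ltW.
by rewrite bs => ?; apply: le_trans wk; lra.
Qed.

(** In a coordinate where d and d' differ, the cells are at least half a spacing, that is 4 radii,
    apart, while a common point of the balls would bring p and q within 2 radii. *)
Lemma subcorner_separated k X d d' (p q : line) : d != d' ->
  cell k.+1 (@subcorner k X d) p -> cell k.+1 (@subcorner k X d') q ->
  cball (@line_dist R n) p (radius k) `&` cball (@line_dist R n) q (radius k)
    = set0.
Proof.
move=> dd' pd qd'; apply/seteqP; split => // y [/= py qy].
have [i di] : exists i, d i != d' i.
  apply/existsP; apply: contraNT dd'; rewrite negb_exists => /forallP H.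
  by apply/eqP/ffunP => i; have := H i; rewrite negbK => /eqP.
have := pd i; have := qd' i; rewrite /subcorner.
have := le_trans (coord_le_line_dist p y i) py.
have := le_trans (coord_le_line_dist q y i) qy.
rewrite !ler_norml.
have := radius_spacing k; have := width_succ R k.
have s0 := spacing_gt0 R k; have r0 := radius_gt0 k.
set a := (d i)%:R; set b := (d' i)%:R.
have : a * spacing R k + spacing R k <= b * spacing R k \/
       b * spacing R k + spacing R k <= a * spacing R k.
  have : a + 1 <= b \/ b + 1 <= a.
    rewrite /a /b !natr1 !ler_nat; move: di; rewrite -val_eqE /=; lia.
  by move=> [ab|ab]; [left|right]; rewrite -[X in _ + X <= _]mul1r -mulrDl ler_pM2r.
move=> [|]; lra.
Qed.

(** With y = 4 [res k] there are y^(6n) subcells, each contributing y^(-4s), and 6n - 4s >= 0. This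
    is the source of the factor 3/2. *)
Lemma packing_mass k (s : R) : s <= 3 / 2 * n%:R ->
  1 <= \sum_(l < #|{ffun index -> 'I_(branch k)}|) (2 * radius k) `^ s.
Proof.
move=> sn; rewrite sumr_const card_ord card_ffun card_sum !card_ord.
rewrite -[X in _ <= X]mulr_natl natrX /branch /branching natrX natrM -exprM.
set y := 4%:R * (res k)%:R.
have y1 : 1 <= y by rewrite /y -natrM ler1n muln_gt0 res_gt0.
have -> : 2 * radius k = y `^ (- 4) by rewrite /radius mulrC divfK.
rewrite -powR_mulrn ?(le_trans ler01) // -powRrM -powRD; last first.
  by apply/implyP => _; rewrite gt_eqF // (lt_le_trans ltr01).
rewrite -[X in X <= _](powRr0 y) ler_powR // natrM natrD.
lra.
Qed.

(* Baire's argument: level [k] serves the set number [logn 2 k.+1], so that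
   every set is served at arbitrarily large levels; the nested cells are chosen
   to avoid the set being served unless each subcell meets it, in which case
   picking one point per subcell gives a packing of mass at least one. *)
Lemma cantor_cover_packing (F : nat -> set line) (s : R) :
  s <= 3 / 2 * n%:R ->
  (forall p, (forall i, cantor (line_coord p i)) -> exists j, F j p) ->
  exists j, forall delta, 0 < delta ->
    exists N (x : 'I_N -> line) (r : 'I_N -> R),
      is_packing (@line_dist R n) (F j) delta x r /\
      1 <= \sum_(k < N) (2 * r k) `^ s.
Proof.
move=> sn coverF; apply: contrapT => /forallNP noF.
have : forall j, exists delta, 0 < delta /\
    ~ exists N (x : 'I_N -> line) (r : 'I_N -> R),
      is_packing (@line_dist R n) (F j) delta x r /\
      1 <= \sum_(k < N) (2 * r k) `^ s.
  by move=> j; have /existsNP[delta /not_implyP] := noF j; exists delta.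
move=> /choice[delta deltaP].
pose served k := logn 2 k.+1.
pose misses k X d := forall p, F (served k) p -> ~ cell k.+1 (@subcorner k X d) p.
have avoid k X : exists d, (exists d', misses k X d') -> misses k X d.
  have [[d dP]|nd] := pselect (exists d, misses k X d); first by exists d.
  (* Here every subcell meets the set being served, and any choice will do. *)
  by exists [ffun=> Ordinal (branch_gt0 k)].
pose D k X := projT1 (cid (avoid k X)).
have DP k X : (exists d, misses k X d) -> misses k X (D k X).
  exact: projT2 (cid (avoid k X)).
pose X := fix X k : index -> R :=
  if k is k'.+1 then @subcorner k' (X k') (D k' (X k')) else fun=> 0.
have XS k i : X k.+1 i = X k i + (D k (X k) i)%:R * spacing R k by [].
have Xcorner k i : X k i \in corners R k.
  elim: k => [|k IH]; first by rewrite inE.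
  by rewrite XS corners_succ.
have Xnest l k i : (l <= k)%N ->
    X l i <= X k i /\ X k i + width R k <= X l i + width R l.
  move=> /subnK <-; elim: (k - l)%N => [|m [IH1 IH2]]; first by rewrite add0n.
  rewrite addSn XS; have := nested_interval R (ltn_ord (D (m + l)%N (X (m + l)%N) i)).
  have := spacing_gt0 R (m + l); set c := spacing _ _ => c0.
  have : 0 <= (D (m + l)%N (X (m + l)%N) i)%:R * c by rewrite mulr_ge0 // ltW.
  by move=> ? ?; split; lra.
pose lim i := sup (range (fun k => X k i)).
have limP k i : X k i <= lim i <= X k i + width R k.
  have ub l : X l i <= X k i + width R k.
    have [lk|/ltnW kl] := leqP l k.
      by have [] := Xnest _ _ i lk; have := width_gt0 R k; lra.
    by have [] := Xnest _ _ i kl; have := width_gt0 R l; lra.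
  apply/andP; split.
    apply: ub_le_sup; last by exists k.
    by exists (X k i + width R k) => _ [l _ <-].
  by apply: ge_sup; [exists (X k i); exists k|move=> _ [l _ <-]].
(* The common point of the nested cells; all its coordinates lie in the Cantor set. *)
pose p : line := (\row_j lim (inr j), \row_j lim (inl j)).
have pE i : line_coord p i = lim i by case: i => j; rewrite /= mxE.
have [j Fjp] : exists j, F j p.
  by apply: coverF => i k; exists (X k i); rewrite ?pE.
have [d0 nopack] := deltaP j.
have [m mP] := archimedean_inv 1 d0.
(* A level that serves [F j], as 2m+1 is odd, and is at least m, so that the radius is at most
   delta. *)
pose k := (2 ^ j * (2 * m).+1).-1.
have kE : k.+1 = (2 ^ j * (2 * m).+1)%N.
  by rewrite /k prednK // muln_gt0 expn_gt0.
have kj : served k = j.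
  rewrite /served kE lognM ?expn_gt0 // pfactorK // logn_coprime ?addn0 //.
  by rewrite coprime2n /= mul2n odd_double.
have mk : (m <= k)%N.
  rewrite -ltnS kE; apply: (@leq_trans (2 * m).+1); first lia.
  by rewrite leq_pmull // expn_gt0.
(* If some subcell missed [F j], the chosen one would miss it too, yet that one contains [p], a
   point of [F j]. *)
have meets d : exists q, F j q /\ cell k.+1 (@subcorner k (X k) d) q.
  apply: contrapT => no.
  have /DP/(_ p) : exists d, misses k (X k) d.
    by exists d => q; rewrite kj => Fq cq; apply: no; exists q.
  rewrite kj => /(_ Fjp); apply => i; rewrite pE.
  exact: limP k.+1 i.
have [q qP] := choice meets.
apply: nopack; exists #|{ffun index -> 'I_(branch k)}|.
exists (fun l => q (enum_val l)), (fun=> radius k).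
split; last exact: packing_mass.
split=> [l|l l' ll'].
  split; first exact: (qP _).1.
  split; first exact: radius_gt0.
  apply: le_trans (radius_small k) (le_trans _ mP).
  by rewrite mul1r lef_pV2 ?posrE ?ltr0n // ler_nat.
apply: (subcorner_separated _ (qP _).2 (qP _).2).
by apply: contra ll' => /eqP/enum_val_inj ->.
Qed.

Lemma packing_premeasure_ge0 (T : Type) (dist : T -> T -> R) (s : R) (A : set T) :
  (0 <= packing_premeasure dist s A)%E.
Proof.
apply: le_ereal_inf_tmp => _ [delta _ <-]; apply: ereal_sup_ubound.
(* The empty packing; its centres are defined by absurdity since [T] may be empty. *)
exists 0%N, (fun i : 'I_0 => False_rect T (match i with Ordinal _ H => notF H end)).
exists (fun=> 0); split; last by rewrite big_ord0.
by split=> [[]|[]].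
Qed.

(** For s <= 3n/2, one piece of any countable cover has premeasure at least 1, so the packing
    measure cannot vanish. *)
Lemma packing_dim_cantor (A : set line) :
  (forall p, (forall i, cantor (line_coord p i)) -> A p) ->
  ((3 / 2 * n%:R)%:E <= packing_dim (@line_dist R n) A)%E.
Proof.
move=> cantorA; apply: le_ereal_inf_tmp => _ [s [s0 ps0] <-].
rewrite lee_fin leNgt; apply/negP => /ltW sn.
suff : (1 <= packing_measure (@line_dist R n) s A)%E by rewrite ps0 lee_fin ler10.
apply: le_ereal_inf_tmp => _ [F AF <-].
have [|j jP] := cantor_cover_packing (F := F) sn.
  by move=> p /cantorA /AF [j _ Fp]; exists j.
apply: (@le_trans _ _ (packing_premeasure (@line_dist R n) s (F j))).
  apply: le_ereal_inf_tmp => _ [delta /jP[N [x [r [pk mass]]]] <-].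
  apply: (@le_trans _ _ (\sum_(k < N) (2 * r k) `^ s)%:E); first by rewrite lee_fin.
  by apply: ereal_sup_ubound; exists N, x, r.
apply: le_trans (nneseries_lim_ge j.+1 _) => [|i _ _]; last first.
  exact: packing_premeasure_ge0.
rewrite big_nat_recr //= leeDr //.
by apply: sume_ge0 => i _; exact: packing_premeasure_ge0.
Qed.

End PackingDimension.

(** * The Kakeya set in all dimensions *)

Section KakeyaSet.
Variables (R : realType) (m : nat).

Local Notation n := m.+1.

Definition planar (x y : R) : Prop := kakeya_plane x y \/ cantor_lines x y.

(** The cutoff 3 exceeds every coordinate of the segments used below, which are at most 2 in
    absolute value. *)
Definition cylinder : set 'rV[R]_n.+1 :=
  [set x | planar (x 0 0) (x 0 ord_max) /\ forall i, `|x 0 i| <= 3].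

Definition kakeya_set : set 'rV[R]_n.+1 := closure cylinder.

Lemma planar_null eta : 0 < eta -> covered planar eta.
Proof.
move=> eta0; have eta2 : 0 < eta / 2 by lra.
apply: (covered_sub _ _ (coveredU (kakeya_plane_null eta2)
  (cantor_lines_null eta2))) => //; lra.
Qed.

Lemma box_compact d (lo hi : 'rV[R]_d) : compact (box lo hi).
Proof.
have -> : box lo hi = [set v | forall i, `[lo 0 i, hi 0 i]%classic (v ord0 i)].
  by apply/seteqP; split => v bv i; have := bv i; rewrite /= in_itv.
apply: (@rV_compact R d (fun i => `[lo 0 i, hi 0 i]%classic)) => i.
exact: segment_compact.
Qed.

Lemma box_closed d (lo hi : 'rV[R]_d) : closed (box lo hi).
Proof.
apply: (compact_closed _ (@box_compact d lo hi)); exact: norm_hausdorff.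
Qed.

Lemma kakeya_set_compact : compact kakeya_set.
Proof.
apply: (@subclosed_compact _ _ (box (const_mx (-3)) (const_mx 3))).
- exact: closed_closure.
- exact: box_compact.
- rewrite [X in _ `<=` X](closure_id _).1; last exact: box_closed.
  apply: closureS => x [_ x3] i; rewrite !mxE.
  by have := x3 i; rewrite ler_norml.
Qed.

Lemma ord_max_neq0 : (ord_max : 'I_n.+1) != 0.
Proof. by []. Qed.

Lemma kakeya_set_Kakeya : Kakeya kakeya_set.
Proof.
split=> [|e e1]; first exact: kakeya_set_compact.
have le1 i : `|e 0 i| <= 1 by rewrite -e1 coord_le_enorm.
have [x [y xyP]] := kakeya_plane_segment (le1 0) (le1 ord_max).
(* The plane supplies the outer two coordinates of the starting point; the middle ones start at 0
   and move by at most 1. *)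
pose z : 'rV[R]_n.+1 :=
  \row_i (if i == 0 then x else if i == ord_max then y else 0).
exists z => _ [l l01 <-]; apply: subset_closure.
have -> : (1 - l) *: z + l *: (z + e) = z + l *: e.
  by rewrite scalerBl scale1r scalerDr addrA subrK.
have := xyP l l01 => kp; have [b0 b1] := kakeya_plane_bounded kp.
split; first by left; rewrite !mxE !eqxx (negbTE ord_max_neq0).
move=> i; rewrite !mxE; case: eqVneq => [->//|_]; case: eqVneq => [->//|_].
have /andP[l0 l1] := l01; rewrite add0r normrM (ger0_norm l0).
by apply: le_trans (ler_pM l0 (normr_ge0 _) l1 (le1 i)) _; lra.
Qed.

(** Corners of the product of a rectangle with [-3,3]^m: the lower one for c = 0, the upper one for
    c = 1. *)
Definition lift_box (b : (R * R) * (R * R)) (c : R) : 'rV[R]_n.+1 :=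
  \row_i (if i == 0 then b.1.1 + c * b.2.1 else
          if i == ord_max then b.1.2 + c * b.2.2 else - 3 + c * 6).

Lemma lift_box_vol b :
  box_vol (lift_box b 0) (lift_box b 1) = b.2.1 * b.2.2 * 6 ^+ m.
Proof.
rewrite /box_vol big_ord_recl big_ord_recr /= !mxE /=.
under eq_bigr => i _.
  have -> : lift_box b 1 0 (lift ord0 (widen_ord (leqnSn m) i)) -
            lift_box b 0 0 (lift ord0 (widen_ord (leqnSn m) i)) = 6.
    have mid : lift ord0 (widen_ord (leqnSn m) i) == (ord_max : 'I_m.+2) = false.
      by apply/negbTE; rewrite -val_eqE /= /bump /=; have := ltn_ord i; lia.
    rewrite !mxE /= mid.
    by ring.
  over.
rewrite prodr_const card_ord.
have -> : lift ord0 (ord_max : 'I_m.+1) = (ord_max : 'I_m.+2) by apply: val_inj.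
rewrite eqxx.
by ring.
Qed.

(** A planar cover lifts to finitely many closed boxes; their union is closed, hence contains the
    closure of the cylinder. *)
Lemma kakeya_set_null : lebesgue_null kakeya_set.
Proof.
move=> eps eps0.
have c0 : 0 < 6 ^+ m :> R by rewrite exprn_gt0.
(* The factor 6^m pays for the middle sides, and the half makes the final inequality strict. *)
have eta0 : 0 < eps / 2 / 6 ^+ m by rewrite !divr_gt0.
have [bs [bs0 bsP bsA]] := planar_null eta0.
(* Beyond the end of the list the sequence continues with a degenerate box of volume 0. *)
pose b0 : (R * R) * (R * R) := ((0, 0), (0, 0)).
pose b k := nth b0 bs k.
have b_ge0 k : 0 <= (b k).2.1 /\ 0 <= (b k).2.2.
  have [kbs|kbs] := ltnP k (size bs); first by apply: bs0; rewrite mem_nth.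
  by rewrite /b nth_default.
exists (fun k => lift_box (b k) 0), (fun k => lift_box (b k) 1); split; [|split].
- move=> k i; rewrite !mxE !mul0r !mul1r !addr0; have [? ?] := b_ge0 k.
  by case: ifP => _; [lra|case: ifP => _; lra].
- pose U := \big[setU/set0]_(c <- bs) box (lift_box c 0) (lift_box c 1).
  have Ucl : closed U by apply: closed_bigsetU => c _; exact: box_closed.
  apply: (@subset_trans _ U).
    rewrite ((closure_id U).1 Ucl); apply: closureS => x [/bsP[c cbs [cx cy]] x3].
    rewrite /U -bigcup_seq; exists c => //= i; rewrite !mxE !mul0r !mul1r !addr0.
    case: eqVneq => [->//|_]; case: eqVneq => [->//|_].
    by have := x3 i; rewrite ler_norml; lra.
  rewrite /U -bigcup_seq => x [c /= cbs cx].
  by exists (index c bs) => //; rewrite /b nth_index.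
- move=> N; under eq_bigr do rewrite lift_box_vol.
  rewrite -mulr_suml.
  have le_bs : \sum_(k < N) (b k).2.1 * (b k).2.2 <= \sum_(c <- bs) c.2.1 * c.2.2.
    have t0 k : 0 <= (b k).2.1 * (b k).2.2.
      by have [? ?] := b_ge0 k; exact: mulr_ge0.
    rewrite (big_nth b0) -(big_mkord xpredT (fun k => (b k).2.1 * (b k).2.2)).
    have [Nbs|/ltnW Nbs] := leqP N (size bs).
      rewrite (big_cat_nat (leq0n _) Nbs) //= lerDl.
      by apply: sumr_ge0 => k _; exact: t0.
    rewrite [X in X <= _](big_cat_nat (leq0n _) Nbs) //= [X in _ + X]big1_seq ?addr0 //.
    move=> k; rewrite mem_index_iota => /andP[_ /andP[? _]].
    by rewrite /b nth_default // mul0r.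
  have : \sum_(k < N) (b k).2.1 * (b k).2.2 <= eps / 2 / 6 ^+ m.
    exact: le_trans bsA.
  by rewrite ler_pdivlMr //; lra.
Qed.

Lemma line_pt0 (v a : 'rV[R]_n) (t : R) : line_pt v a t 0 0 = a 0 0 + t * v 0 0.
Proof.
rewrite mxE; case: unliftP => [j|/eqP]; last by rewrite eq_sym (negbTE ord_max_neq0).
by move=> /(congr1 val) /=; rewrite /bump leqNgt ltn_ord /= => j0; rewrite (_ : j = 0) //; apply: val_inj.
Qed.

Lemma line_pt_max (v a : 'rV[R]_n) (t : R) : line_pt v a t 0 ord_max = t.
Proof. by rewrite mxE unlift_none. Qed.

Lemma line_pt_convex (v a : 'rV[R]_n) (t l : R) :
  (1 - l) *: line_pt v a 0 + l *: line_pt v a t = line_pt v a (l * t).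
Proof.
by apply/rowP => i; rewrite !mxE; case: unlift => [j|]; ring.
Qed.

Lemma line_pt_widen (v a : 'rV[R]_n) (t : R) (i : 'I_n) :
  line_pt v a t 0 (widen_ord (leqnSn n) i) = a 0 i + t * v 0 i.
Proof.
rewrite mxE (_ : widen_ord _ i = lift ord_max i) ?liftK //.
by apply: val_inj; rewrite /= /bump leqNgt ltn_ord.
Qed.

Lemma line_pt_speed (v a : 'rV[R]_n) (t : R) : 0 <= t ->
  enorm (line_pt v a t - line_pt v a 0) = t * Num.sqrt (1 + \sum_j v 0 j ^+ 2).
Proof.
move=> t0; rewrite /enorm big_ord_recr /= !mxE unlift_none subr0.
under eq_bigr => i _.
  rewrite mxE [X in _ + X]mxE !line_pt_widen mul0r addr0 addrAC subrr add0r.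
  rewrite exprMn.
  over.
rewrite -mulr_sumr -[X in _ + X]mulr1 -mulrDr addrC.
by rewrite sqrtrM ?sqr_ge0 // sqrtr_sqr ger0_norm.
Qed.

Lemma lineset_kakeya_set p : (forall i, cantor (line_coord p i)) ->
  lineset kakeya_set p.
Proof.
move=> pC; have [aC vC] : (forall j, cantor (p.2 0 j)) /\ (forall j, cantor (p.1 0 j)).
  by split=> j; [exact: (pC (inl j))|exact: (pC (inr j))].
(* The speed of the parametrisation is s >= 1, so the unit segment from height 0 ends at height 1/s
   <= 1, within the range of [cantor_lines]. *)
set s := Num.sqrt (1 + \sum_j p.1 0 j ^+ 2).
have s1 : 1 <= s.
  rewrite -[1]sqrtr1 ler_wsqrtr // lerDl.
  by apply: sumr_ge0 => j _; exact: sqr_ge0.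
have s0 : 0 < s by lra.
have t01 : 0 <= s^-1 <= 1 by rewrite invr_ge0 ltW //= invf_le1.
exists 0, s^-1; split.
  by rewrite line_pt_speed ?mulVf ?gt_eqF //; case/andP: t01.
move=> _ [l l01 <-]; rewrite line_pt_convex; apply: subset_closure.
have /andP[l0 l1] := l01; have /andP[r0 r1] := t01.
have lt01 : 0 <= l * s^-1 <= 1 by rewrite mulr_ge0 //= mulr_ile1.
split.
  right; rewrite line_pt0 line_pt_max; split => //.
  by exists (p.2 0 0), (p.1 0 0).
move=> i; rewrite mxE; case: unliftP => [j _|_]; last by rewrite ler_norml; lra.
have := cantor01 (aC j); have := cantor01 (vC j); move: lt01; set t := l * s^-1.
move=> t1 v1 a1; have : 0 <= t * p.1 0 j <= 1 by apply/andP; split; nra.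
by rewrite ler_norml; lra.
Qed.

Lemma kakeya_set_non_sticky : non_sticky kakeya_set.
Proof.
apply: lt_le_trans (packing_dim_cantor lineset_kakeya_set).
rewrite lte_fin; have : 0 < n%:R :> R by rewrite ltr0n.
lra.
Qed.

End KakeyaSet.

Theorem theorem1p2 (R : realType) :
  (exists K : set 'rV[R]_2,
      Kakeya K /\ non_sticky K /\ lebesgue_null K) /\
  (forall n : nat, (2 < n.+1)%N ->
     exists K : set 'rV[R]_n.+1,
       Kakeya K /\ non_sticky K /\ lebesgue_null K).
Proof.
(* Ambient dimension m + 2 makes the first and last coordinates distinct; m = 0 is the plane. *)
have main m : exists K : set 'rV[R]_m.+2,
    Kakeya K /\ non_sticky K /\ lebesgue_null K.
  exists (@kakeya_set R m); split; first exact: kakeya_set_Kakeya.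
  by split; [exact: kakeya_set_non_sticky|exact: kakeya_set_null].
by split=> [|[|n] // _]; exact: main.
Qed.
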